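(* Let $(X,\widehat{d}_X)$ and $(Y,\widehat{d}_Y)$ be two (non-empty) non-Archimedean metric spaces and denote $D=\max\{\operatorname{diam}(X),\operatorname{diam}(Y)\}$. Then: (1) $\widehat{d}_{GH}(X,Y)\ge\inf\{\varepsilon>0 : W_X(X)_{\ge\varepsilon}=W_Y(Y)_{\ge\varepsilon}\}$. (2) If there does not exist $\varepsilon>0$ such that $W_X(X)_{\ge\varepsilon}=W_Y(Y)_{\ge\varepsilon}$, then $\widehat{d}_{GH}(X,Y)=\infty$. (3A) If $D<+\infty$, then $\widehat{d}_{GH}(X,Y)\le D$. (3B) If $D<+\infty$ and $\operatorname{diam}(X)\ne\operatorname{diam}(Y)$, then $\widehat{d}_{GH}(X,Y)=D$.
   Context: A non-Archimedean metric space $(X,\widehat{d}_X)$ is a set with a metric satisfying the strong triangle inequality $\widehat{d}_X(x,z)\le\max\{\widehat{d}_X(x,y),\widehat{d}_X(y,z)\}$. The non-Archimedean Gromov-Hausdorff distance is $\widehat{d}_{GH}(X,Y)=\inf\{\widehat{d}_{H}(f(X),g(Y))\}$, the infimum being over all non-Archimedean metric spaces $(Z,\widehat{d}_Z)$ and all isometric embeddings $f:X\hookrightarrow Z$, $g:Y\hookrightarrow Z$, where $\widehat{d}_H$ is the Hausdorff distance between subsets of $Z$ (it may be $\infty$). For a metric space $(X,d_X)$, $\operatorname{diam}(X)=\sup\{d_X(x,y):x,y\in X\}$. For a non-empty subset $S\subset X$ and $\varepsilon>0$, $W_X(S)_{\ge\varepsilon}=\{d_X(x,y): x,y\in S,\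 d_X(x,y)\ge\varepsilon\}$. The infimum of the empty set is $+\infty$. *)

(* Defs.v *)
From HB Require Import structures.
From mathcomp Require Import all_boot all_order all_algebra.
From mathcomp Require Import all_classical all_reals all_analysis.

Set Implicit Arguments.
Unset Strict Implicit.
Unset Printing Implicit Defensive.

Import Order.TTheory GRing.Theory Num.Theory.

Local Open Scope classical_set_scope.
Local Open Scope ring_scope.

Definition nonarchimedean (R : realType) (X : metricType R) : Prop :=
  forall x y z : X, mdist x z <= Num.max (mdist x y) (mdist y z).

Definition isometric_embedding (R : realType) (X Z : metricType R)
    (f : X -> Z) : Prop :=
  forall x y : X, mdist (f x) (f y) = mdist x y.

(* [ball z e] is the open ball, so the bigcup is the open e-neighbourhood. The
   infimum is taken in the extended reals: it is +oo if no real e works. *)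
Definition hausdorff_dist (R : realType) (Z : metricType R) (A B : set Z) :
    \bar R :=
  ereal_inf [set e%:E | e in [set e : R |
    [/\ 0 < e, A `<=` \bigcup_(b in B) ball b e
             & B `<=` \bigcup_(a in A) ball a e]]].

Definition nonarch_gh_dist (R : realType) (X Y : metricType R) : \bar R :=
  ereal_inf [set h : \bar R |
    exists (Z : metricType R) (f : X -> Z) (g : Y -> Z),
      [/\ nonarchimedean Z, isometric_embedding f, isometric_embedding g
        & h = hausdorff_dist (range f) (range g)]].

Definition diam (R : realType) (X : metricType R) : \bar R :=
  ereal_sup [set (mdist p.1 p.2)%:E | p in [set: X * X]].

Definition dist_values_ge (R : realType) (X : metricType R) (S : set X)
    (e : R) : set R :=
  [set r | exists x y : X, [/\ S x, S y, mdist x y = r & e <= mdist x y]].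

(* Main.v *)
(* In an ultrametric space the largest two of three distances agree, so moving
   both endpoints by less than e does not change a distance that is at least e.
   Hence images of X and Y at Hausdorff distance less than e have the same
   distance values above e; if the diameters differ, those value sets cannot
   agree for e < D, which gives the lower bounds.  For the upper bound, put all
   points of X at distance c from all points of Y; this is an ultrametric on the
   disjoint union as soon as c >= D and c > 0. *)
Require Import Defs.
From HB Require Import structures.
From mathcomp Require Import all_boot all_order all_algebra.
From mathcomp Require Import all_classical all_reals all_analysis.

Set Implicit Arguments.
Unset Strict Implicit.
Unset Printing Implicit Defensive.

Import Order.TTheory GRing.Theory Num.Theory.

Local Open Scope classical_set_scope.
Local Open Scope ring_scope.

Lemma nonarch_isosceles (R : realType) (Z : metricType R) (x y x' y' : Z)
    (e : R) : nonarchimedean Z -> mdist x x' < e -> mdist y y' < e ->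
  e <= mdist x y -> mdist x' y' = mdist x y.
Proof.
move=> hZ.
(* One inequality suffices: it shows that the moved distance is again at least [e], so it also
   applies with the two pairs exchanged. *)
have le_near (a b a' b' : Z) : mdist a a' < e -> mdist b b' < e ->
    e <= mdist a b -> mdist a b <= mdist a' b'.
  move=> aa' bb' eab; have := hZ a a' b.
  rewrite le_max => /orP[|]; first by rewrite leNgt (lt_le_trans aa').
  move=> aba'; have := le_trans aba' (hZ a' b' b).
  by rewrite le_max => /orP[//|]; rewrite (metric_sym b') leNgt (lt_le_trans bb').
move=> xx' yy' exy; have le_xy := le_near _ _ _ _ xx' yy' exy.
apply: le_anti; rewrite le_xy andbT.
by apply: le_near (le_trans exy le_xy); rewrite metric_sym.
Qed.

(** Each endpoint of a pair in [X] has a partner from [Y] within [e] in [Z], and [nonarch_isosceles]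
    transfers the distance to the partners. *)
Lemma dist_values_ge_subset (R : realType) (X Y Z : metricType R) (f : X -> Z)
    (g : Y -> Z) (e : R) :
  nonarchimedean Z -> isometric_embedding f -> isometric_embedding g ->
  range f `<=` \bigcup_(b in range g) ball b e ->
  dist_values_ge [set: X] e `<=` dist_values_ge [set: Y] e.
Proof.
move=> hZ hf hg fg _ [x [y [_ _ <- exy]]].
have near t : exists s, mdist (f t) (g s) < e.
  have [_ [s _ <-]] := fg (f t) (imageT f t).
  by rewrite ballEmdist /= metric_sym => h; exists s.
have [[x' xx'] [y' yy']] := (near x, near y).
have eq_d : mdist x' y' = mdist x y.
  by rewrite -hg -hf; apply: nonarch_isosceles xx' yy' _; rewrite ?hf.
by exists x', y'; rewrite eq_d.
Qed.

(** Every radius admissible for a Hausdorff distance in some common [Z] belongs to the set on the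
    left. *)
Lemma nonarch_gh_dist_ge_values (R : realType) (X Y : metricType R) :
  (ereal_inf [set e%:E | e in [set e : R | (0 < e)%R /\
     dist_values_ge [set: X] e = dist_values_ge [set: Y] e]]
   <= nonarch_gh_dist X Y)%E.
Proof.
apply: le_ereal_inf_tmp => _ [Z [f [g [hZ hf hg ->]]]].
apply: le_ereal_inf_tmp => _ [e [e0 fg gf] <-].
apply: ereal_inf_lbound; exists e => //; split=> //.
by apply/seteqP; split; apply: dist_values_ge_subset hZ _ _ _; eassumption.
Qed.

Definition glue_dist (R : realType) (X Y : metricType R) (e : R)
    (a b : X + Y) : R :=
  match a, b with
  | inl x, inl x' => mdist x x'
  | inr y, inr y' => mdist y y'
  | _, _ => e
  end.

(** If [a] and [c] lie on different sides, [b] is at distance [e] from one of them. If only [b] lies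
    on the other side, the maximum is [e], which bounds all distances within a side. *)
Lemma glue_dist_ultra (R : realType) (X Y : metricType R) (e : R) :
  nonarchimedean X -> nonarchimedean Y ->
  (forall x x' : X, mdist x x' <= e) -> (forall y y' : Y, mdist y y' <= e) ->
  forall a b c : X + Y,
    glue_dist e a c <= Num.max (glue_dist e a b) (glue_dist e b c).
Proof.
move=> hX hY Xe Ye [x|y] [x'|y'] [x''|y''] /=; rewrite ?hX ?hY //;
  by rewrite le_max ?lexx ?orbT ?Xe ?Ye.
Qed.

Section glue.
Context (R : realType) (X Y : metricType R) (e : R).
Context (e0 : 0 < e) (hX : nonarchimedean X) (hY : nonarchimedean Y).
Context (Xe : forall x x' : X, mdist x x' <= e).
Context (Ye : forall y y' : Y, mdist y y' <= e).

Let T : Type := (X + Y)%type.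
HB.instance Definition _ := Choice.on T.

Let dist : T -> T -> R := glue_dist e.

Let distxx a : dist a a = 0.
Proof. by case: a => t; exact: mdistxx. Qed.

Let dist_positivity a b : dist a b = 0 -> a = b.
Proof.
case: a b => [x|y] [x'|y'] /= => [/mdist_positivity->|h|h|/mdist_positivity->];
  by have := e0; rewrite // h ltxx.
Qed.

Let dist_sym a b : dist a b = dist b a.
Proof. by case: a b => [x|y] [x'|y'] //=; exact: metric_sym. Qed.

Let dist_ge0 a b : 0 <= dist a b.
Proof. by case: a b => [x|y] [x'|y'] /=; rewrite ?mdist_ge0// ltW. Qed.

Let dist_triangle b a c : dist a c <= dist a b + dist b c.
Proof.
apply: le_trans (glue_dist_ultra hX hY Xe Ye a b c) _.
by rewrite ge_max lerDl lerDr !dist_ge0.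
Qed.

HB.instance Definition _ :=
  isMetric.Build R T distxx dist_positivity dist_sym dist_triangle.

(** Packages the glued metric on [T] so that later arguments use only these four properties. *)
Lemma exists_glueing : exists (Z : metricType R) (f : X -> Z) (g : Y -> Z),
  [/\ nonarchimedean Z, isometric_embedding f, isometric_embedding g
    & forall x y, mdist (f x) (g y) = e].
Proof.
exists T, inl, inr; split=> //.
exact: (glue_dist_ultra hX hY Xe Ye).
Qed.

End glue.

Lemma diam_ge (R : realType) (X : metricType R) (x y : X) :
  ((mdist x y)%:E <= diam X)%E.
Proof. by apply: ereal_sup_ubound; exists (x, y). Qed.

Lemma diam_ge0 (R : realType) (X : metricType R) :
  [set: X] !=set0 -> (0 <= diam X)%E.
Proof. by move=> [x _]; have := diam_ge x x; rewrite mdistxx. Qed.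

Lemma nonarch_gh_dist_le_diam (R : realType) (X Y : metricType R) :
  [set: X] !=set0 -> [set: Y] !=set0 ->
  nonarchimedean X -> nonarchimedean Y ->
  (nonarch_gh_dist X Y <= Order.max (diam X) (diam Y))%E.
Proof.
move=> X0 Y0 hX hY; apply/lee_addgt0Pr.
set D := Order.max _ _ => r r0.
have D0 : (0 <= D)%E by rewrite le_max diam_ge0.
have XD (x x' : X) : ((mdist x x')%:E <= D)%E by rewrite le_max diam_ge.
have YD (y y' : Y) : ((mdist y y')%:E <= D)%E by rewrite le_max diam_ge orbT.
(* An infinite [D] makes the bound trivial, and [D0] excludes the value -oo. *)
case: D D0 XD YD => [d|_ _ _|//]; last by rewrite addye ?leey.
rewrite lee_fin => d0 Xd Yd.
(* For D = 0 the glueing distance must exceed D to keep the two pieces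
   disjoint, hence the slack r / 2. *)
have r2 : d + r / 2 < d + r by rewrite ltrD2l ltr_pdivrMr// ltr_pMr// ltr1n.
have dr2 : d <= d + r / 2 by rewrite lerDl divr_ge0// ltW.
have c0 : 0 < d + r / 2 by rewrite ltr_wpDl// divr_gt0.
have Xc (x x' : X) : mdist x x' <= d + r / 2.
  by rewrite (le_trans _ dr2)// -lee_fin.
have Yc (y y' : Y) : mdist y y' <= d + r / 2.
  by rewrite (le_trans _ dr2)// -lee_fin.
have [Z [f [g [hZ hf hg fgE]]]] := exists_glueing c0 hX hY Xc Yc.
apply: (@le_trans _ _ (hausdorff_dist (range f) (range g))).
  by apply: ereal_inf_lbound; exists Z, f, g.
(* The balls are open, so the radius must strictly exceed the glueing distance [d + r / 2]. *)
apply: ereal_inf_lbound; exists (d + r) => //; split.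
- exact: ltr_wpDl.
- move=> _ [x _ <-]; have [y _] := Y0.
  by exists (g y) => //; rewrite ballEmdist /= metric_sym fgE.
- move=> _ [y _ <-]; have [x _] := X0.
  by exists (f x) => //; rewrite ballEmdist /= fgE.
Qed.

(** Otherwise some distance in [Y] exceeds both [diam X] and [e]; equality of the value sets makes
    it a distance in [X], which is absurd. *)
Lemma diam_le_of_dist_values_ge (R : realType) (X Y : metricType R) (e : R) :
  (diam X < diam Y)%E ->
  dist_values_ge [set: X] e = dist_values_ge [set: Y] e ->
  (diam Y <= e%:E)%E.
Proof.
move=> XY XYe; rewrite leNgt; apply/negP => eY.
have /ereal_sup_gt[_ [[y y'] _ <-]] : (Order.max (diam X) e%:E < diam Y)%E.
  by rewrite gt_max XY.
rewrite gt_max lte_fin /= => /andP[Xyy' eyy'].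
have : dist_values_ge [set: Y] e (mdist y y').
  by exists y, y'; split=> //; exact: ltW.
rewrite -XYe => -[x [x' [_ _ xx' _]]].
by have := diam_ge x x'; rewrite xx' leNgt Xyy'.
Qed.

Lemma max_diam_le_of_dist_values_ge (R : realType) (X Y : metricType R)
    (e : R) : diam X <> diam Y ->
  dist_values_ge [set: X] e = dist_values_ge [set: Y] e ->
  (Order.max (diam X) (diam Y) <= e%:E)%E.
Proof.
move=> /eqP; rewrite neq_lt => /orP[] lt_diam eqe.
  by rewrite (max_idPr (ltW lt_diam)) (diam_le_of_dist_values_ge lt_diam).
by rewrite (max_idPl (ltW lt_diam)) (diam_le_of_dist_values_ge lt_diam).
Qed.

Theorem theoremE (R : realType) (X Y : metricType R)
    (hX0 : [set: X] !=set0) (hY0 : [set: Y] !=set0)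
    (hX : nonarchimedean X) (hY : nonarchimedean Y) :
  let D : \bar R := Order.max (diam X) (diam Y) in
  [/\ (ereal_inf [set e%:E | e in [set e : R | (0 < e)%R /\
         dist_values_ge [set: X] e = dist_values_ge [set: Y] e]]
       <= nonarch_gh_dist X Y)%E,
      ~ (exists e : R, 0 < e /\
           dist_values_ge [set: X] e = dist_values_ge [set: Y] e) ->
        nonarch_gh_dist X Y = +oo%E,
      (D < +oo)%E -> (nonarch_gh_dist X Y <= D)%E
    & (D < +oo)%E -> diam X <> diam Y -> nonarch_gh_dist X Y = D].
Proof.
move=> D; have ge_values := nonarch_gh_dist_ge_values X Y.
have leD : (nonarch_gh_dist X Y <= D)%E by exact: nonarch_gh_dist_le_diam.
split=> // [noe | _ neq_diam].
  (* The lower bound is now the infimum of an empty set, hence +oo. *)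
  apply/eqP; rewrite -leye_eq; apply: le_trans ge_values.
  by apply: le_ereal_inf_tmp => _ [e he <-]; case: noe; exists e.
(* For the reverse inequality, unequal diameters force every admissible [e] to be at least [D]. *)
apply/eqP; rewrite eq_le leD; apply: le_trans ge_values.
apply: le_ereal_inf_tmp => _ [e [_ eqe] <-].
exact: max_diam_le_of_dist_values_ge.
Qed.
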